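(* Let $p$ be an odd prime and $\epsilon\ge0$. Let $X\subseteq\mathbb{H}_1(\mathbb{F}_p)$ and $P=A\times B\subseteq\mathbb{F}_p^3\times\mathbb{F}_p^3$. Assume that every point of $A$ and of $B$ has nonzero third coordinate, and that for every $(y,z)\in\mathbb{F}_p^2$ we have $|\pi_{23}^{-1}(y,z)\cap B|\le p^{1-\epsilon}$. Then \[\left|I(P,X)-\frac{|P||X|}{p^3}\right|\le p^{\frac{3-\epsilon}{2}}|P|^{1/2}|X|^{1/2}.\]
   Context: $\mathbb{H}_1(\mathbb{F}_p)$ is the group of matrices $[x,y,t]=\begin{pmatrix}1&x&t\\0&1&y\\0&0&1\end{pmatrix}$, $x,y,t\in\mathbb{F}_p$, acting on $\mathbb{F}_p^3$ by multiplication on column vectors. A pair $(x,y)\in\mathbb{F}_p^3\times\mathbb{F}_p^3$ is incident to $\theta\in\mathbb{H}_1(\mathbb{F}_p)$ if $\theta y=x$, and $I(P,X)$ is the number of pairs $((x,y),\theta)\in P\times X$ with $\theta y=x$. $\pi_{23}(x,y,z)=(y,z)$. *)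

(* Defs.v *)
From HB Require Import structures.
From mathcomp Require Import all_boot all_order all_algebra.
From mathcomp Require Import all_reals all_analysis.

Set Implicit Arguments.
Unset Strict Implicit.
Unset Printing Implicit Defensive.

Import Order.TTheory GRing.Theory Num.Theory.

Local Open Scope ring_scope.

Definition heis (F : finFieldType) (x y t : F) : 'M[F]_3 :=
  \matrix_(i < 3, j < 3)
    nth 0 (nth [::] [:: [:: 1; x; t];
                        [:: 0; 1; y];
                        [:: 0; 0; 1]] i) j.

Definition heisenberg (F : finFieldType) : {set 'M[F]_3} :=
  [set heis u.1.1 u.1.2 u.2 | u : F * F * F].

(* Coordinates are 0-based: the indices [1] and [2] of ['I_3] are the second
   and third coordinates. *)
Definition pi23 (F : finFieldType) (u : 'cV[F]_3) : F * F :=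
  (u 1 0, u 2%:R 0).

Definition incidence (F : finFieldType) (P : {set 'cV[F]_3 * 'cV[F]_3})
    (X : {set 'M[F]_3}) : nat :=
  #|[set w in setX P X | w.2 *m w.1.2 == w.1.1]|.

(* Main.v *)
(** Both [I(P,X)] and [|P||X|/p^3] lie between 0 and the right-hand side, so
    their difference does too.  Write [K = p^(1-e)].  An incidence is determined
    by [theta] and [b], so [I <= |X||B|].  It is also determined by [a], [b] and
    the entry [x] of [theta] (as [b_3 <> 0]), where [b_3 = a_3] leaves at most
    [p K] choices of [b], so [I <= |A| p^2 K].  The product of the two bounds is
    [I^2 <= p^2 K |P||X|].  For the other term, [|A| <= p^3], [|B| <= p^2 K] and
    [|X| <= p^3] give [|P||X| <= p^8 K]. *)
Require Import Defs.
From HB Require Import structures.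
From mathcomp Require Import all_boot all_order all_algebra.
From mathcomp Require Import all_reals all_analysis.
From mathcomp Require Import ring.

Set Implicit Arguments.
Unset Strict Implicit.
Unset Printing Implicit Defensive.

Import Order.TTheory GRing.Theory Num.Theory.

Local Open Scope ring_scope.

Section Counting.
Variable F : finFieldType.
Implicit Types (A B : {set 'cV[F]_3}) (X : {set 'M[F]_3}).

Lemma card_heisenberg_le : (#|heisenberg F| <= #|F| ^ 3)%N.
Proof.
apply: leq_trans (leq_imset_card _ _) _.
by rewrite !card_prod !expnS expn0 muln1 mulnA.
Qed.

Lemma heis_mul_col (x y t : F) (b : 'cV[F]_3) :
  [/\ (heis x y t *m b) 0 0 = b 0 0 + x * b 1 0 + t * b 2%:R 0,
      (heis x y t *m b) 1 0 = b 1 0 + y * b 2%:R 0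
    & (heis x y t *m b) 2%:R 0 = b 2%:R 0].
Proof.
(* Expanding the sum with [big_ord_recl] produces iterated lifts; these must be matched with the
   numerals of the ring ['I_3]. *)
have E2 : lift ord0 (lift ord0 ord0) = 2%:R :> 'I_3 by apply/val_inj.
have E1 : lift ord0 ord0 = 1 :> 'I_3 by apply/val_inj.
by split; rewrite mxE !big_ord_recl big_ord0 !mxE /= ?E2 ?E1; ring.
Qed.

(** For fixed [x] and [b], the second and first coordinates of the product are affine in [y] and [t]
    respectively, both with slope $b_3 \ne 0$. *)
Lemma heis_inj_col (x y y' t t' : F) (b : 'cV[F]_3) : b 2%:R 0 != 0 ->
  heis x y t *m b = heis x y' t' *m b -> heis x y t = heis x y' t'.
Proof.
move=> b0 E.
have [e0 e1 _] := heis_mul_col x y t b.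
have [e0' e1' _] := heis_mul_col x y' t' b.
move: e0 e1; rewrite E e0' e1' => /addrI /(mulIf b0) -> /addrI /(mulIf b0) ->.
by [].
Qed.

Section FiberBound.
Variables (B : {set 'cV[F]_3}) (k : nat).
Hypothesis fiberB : forall y z : F,
  (#|(@pi23 F) @^-1: [set (y, z)] :&: B| <= k)%N.

(** Fixing the second coordinate as well cuts the layer into $|F|$ fibres of [pi23]. Layers matter
    because Heisenberg matrices preserve the third coordinate. *)
Lemma card_layer_le (z : F) : (#|[set b in B | (b 2%:R 0 == z)%R]| <= #|F| * k)%N.
Proof.
rewrite -sum1_card (partition_big (fun b : 'cV[F]_3 => b 1 0) predT) //=.
rewrite -sum_nat_const; apply: leq_sum => y _.
apply: leq_trans (fiberB y z); rewrite -sum1_card.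
rewrite [leqRHS](eq_bigl (fun b : 'cV[F]_3 =>
  (b \in [set b in B | b 2%:R 0 == z]) && (b 1 0 == y))) // => b.
by rewrite !inE xpair_eqE; case: (b \in B); case: eqP; case: eqP.
Qed.

Lemma card_fibered_le : (#|B| <= #|F| * (#|F| * k))%N.
Proof.
rewrite -sum1_card (partition_big (fun b : 'cV[F]_3 => b 2%:R 0) predT) //=.
rewrite -sum_nat_const; apply: leq_sum => z _.
apply: leq_trans (card_layer_le z); rewrite -sum1_card.
by rewrite [leqRHS](eq_bigl (fun b : 'cV[F]_3 => (b \in B) && (b 2%:R 0 == z)))
  // => b; rewrite !inE.
Qed.

Lemma incidence_le_card_fst A X : X \subset heisenberg F ->
    (forall b, b \in B -> b 2%:R 0 != 0) ->
  (incidence (setX A B) X <= #|A| * (#|F| * (#|F| * k)))%N.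
Proof.
move=> /subsetP sX nzB; rewrite /incidence.
set S := [set w in _ | _].
(* The entry [w.2 0 1] is the parameter [x] of the matrix; [y] and [t] can be forgotten since
   [heis_inj_col] recovers them. Putting [a] first lets the image be fibred over [A]. *)
pose f (w : 'cV[F]_3 * 'cV[F]_3 * 'M[F]_3) := (w.1.1, (w.2 0 1, w.1.2)).
have heisX w : w \in S -> [/\ w.1.1 \in A, w.1.2 \in B, w.2 *m w.1.2 = w.1.1
    & exists y t, w.2 = heis (w.2 0 1) y t].
  rewrite !inE => /andP[/andP[/andP[wA wB] /sX wX] /eqP E]; split => //.
  have /imsetP[[[x y] t] _ ->] := wX.
  by exists y, t; congr heis; rewrite mxE.
have f_inj : {in S &, injective f}.
  move=> w w' /heisX[_ wB E [y [t Et]]] /heisX[_ _ E' [y' [t' Et']]] [ea ex eb].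
  suff: w.2 = w'.2 by move: ea eb; case: (w) (w') => [[? ?] ?] [[? ?] ?] /= -> -> ->.
  rewrite Et Et' -ex; apply: (heis_inj_col (nzB _ wB)).
  by rewrite [in RHS]ex -Et -Et' [in RHS]eb E E'.
rewrite -(card_in_imset f_inj).
pose T := [set v : 'cV[F]_3 * (F * 'cV[F]_3) |
  (v.1 \in A) && ((v.2.2 \in B) && (v.2.2 2%:R 0 == v.1 2%:R 0))].
have sT : f @: S \subset T.
  apply/subsetP => _ /imsetP[w /heisX[wA wB E [y [t Et]]] ->]; rewrite inE /=.
  have [_ _ e2] := heis_mul_col (w.2 0 1) y t w.1.2.
  by rewrite wA wB -E Et e2 eqxx.
apply: leq_trans (subset_leq_card sT) _.
rewrite -sum1_card (partition_big (fun v => v.1) (mem A)) /=; last first.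
  by move=> v; rewrite inE => /andP[].
rewrite -sum_nat_const; apply: leq_sum => a aA.
pose L := [set b in B | b 2%:R 0 == a 2%:R 0].
(* Over a given [a], the parameter [x] is free and [b] ranges over the layer of [B] at the height of
   [a]. *)
apply: (@leq_trans #|setX [set: F] L|); last first.
  by rewrite cardsX cardsT leq_mul2l card_layer_le orbT.
have inj_a : injective (pair a : F * 'cV[F]_3 -> _) by move=> ? ? [].
rewrite sum1_card -(card_imset (setX [set: F] L) inj_a).
apply/subset_leq_card/subsetP => -[a' [x b]]; rewrite unfold_in /= !inE /=.
case/andP => /andP[_ bB] /eqP ea; subst a'.
by rewrite mem_imset // !inE bB.
Qed.

End FiberBound.

Lemma incidence_le_card_snd A B X : (incidence (setX A B) X <= #|X| * #|B|)%N.
Proof.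
rewrite /incidence -cardsX; set S := [set w in _ | _].
pose f (w : 'cV[F]_3 * 'cV[F]_3 * 'M[F]_3) := (w.2, w.1.2).
have f_inj : {in S &, injective f}.
  move=> [[a b] M] [[a' b'] M']; rewrite !inE /= => /andP[_ /eqP <-].
  by move=> /andP[_ /eqP <-] [-> ->].
rewrite -(card_in_imset f_inj); apply/subset_leq_card/subsetP.
move=> _ /imsetP[[[a b] M] wS ->]; move: wS; rewrite !inE /=.
by case/andP => /andP[/andP[_ ->] ->].
Qed.

End Counting.

Theorem theorem4p1 (R : realType) (p : nat) (e : R)
    (X : {set 'M['F_p]_3}) (A B : {set 'cV['F_p]_3}) :
  prime p -> odd p -> 0 <= e ->
  X \subset heisenberg 'F_p ->
  (forall a, a \in A -> a 2%:R 0 != 0) ->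
  (forall b, b \in B -> b 2%:R 0 != 0) ->
  (forall y z : 'F_p,
     #|(@pi23 'F_p) @^-1: [set (y, z)] :&: B|%:R <= p%:R `^ (1 - e)) ->
  let P := setX A B in
  `| (incidence P X)%:R - #|P|%:R * #|X|%:R / p%:R ^+ 3 |
    <= p%:R `^ ((3 - e) / 2) * #|P|%:R `^ (1 / 2) * #|X|%:R `^ (1 / 2).
Proof.
move=> p_pr _ _ sX _ nzB fiberB; cbv zeta; set P := setX A B.
have p_gt0 : 0 < p%:R :> R by rewrite ltr0n prime_gt0.
set K := p%:R `^ (1 - e) in fiberB.
(* Cardinalities are integers, so the fibre bound survives truncation and the counting takes place
   in [nat]. *)
pose k := Num.truncn K.
have kK : k%:R <= K by rewrite truncn_le powR_ge0.
have fiberk y z : (#|(@pi23 'F_p) @^-1: [set (y, z)] :&: B| <= k)%N.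
  by rewrite truncn_ge_nat ?powR_ge0.
have cP : #|P| = (#|A| * #|B|)%N by rewrite cardsX.
have cA : (#|A| <= p ^ 3)%N.
  by apply: leq_trans (max_card _) _; rewrite card_mx card_Fp.
have cB := card_fibered_le fiberk.
have cX : (#|X| <= p ^ 3)%N.
  apply: leq_trans (subset_leq_card sX) _.
  by rewrite -[X in (_ <= X ^ _)%N](card_Fp p_pr) card_heisenberg_le.
have I1 := incidence_le_card_fst fiberk A sX nzB.
have I2 := incidence_le_card_snd A B X.
rewrite card_Fp // in cB I1.
(* Since $3-e = 2+(1-e)$, the power of $p$ is $\sqrt{p^2K}$; under a single root, both estimates
   reduce to comparing squares. *)
have rhsE : p%:R `^ ((3 - e) / 2) * #|P|%:R `^ (1 / 2) * #|X|%:R `^ (1 / 2)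
    = Num.sqrt (p%:R ^+ 2 * K * (#|P| * #|X|)%:R).
  have -> : (3 - e) / 2 = (2 + (1 - e)) * 2^-1 by field.
  rewrite !div1r powRrM !powR12_sqrt ?powR_ge0 ?ler0n // powRD; last first.
    by rewrite (gt_eqF p_gt0) implybT.
  rewrite powR_mulrn ?ler0n // natrM -/K.
  by rewrite -!sqrtrM ?mulr_ge0 ?exprn_ge0 ?ler0n ?powR_ge0 // mulrA.
have le_rhs (x : R) : 0 <= x -> x ^+ 2 <= p%:R ^+ 2 * k%:R * (#|P| * #|X|)%:R ->
    x <= Num.sqrt (p%:R ^+ 2 * K * (#|P| * #|X|)%:R).
  move=> x0 xk; rewrite -[x]ger0_norm // -sqrtr_sqr ler_wsqrtr //.
  by apply: le_trans xk _; rewrite ler_wpM2r ?ler0n // ler_wpM2l ?exprn_ge0 ?ler0n.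
rewrite rhsE.
have m_ge0 : 0 <= #|P|%:R * #|X|%:R / p%:R ^+ 3 :> R.
  by rewrite divr_ge0 ?mulr_ge0 ?exprn_ge0 ?ler0n.
rewrite ler_norml; apply/andP; split.
  (* Lower bound: drop the incidences. After squaring, one factor $|P||X|$ cancels, leaving $|P||X|
     \le p^8k$. *)
  rewrite lerBrDl lerBlDr ler_wpDl ?ler0n //; apply: le_rhs => //.
  rewrite expr_div_n ler_pdivrMr ?exprn_gt0 // -natrM -!natrX -!natrM ler_nat.
  rewrite expnS expn1 [leqRHS]mulnAC leq_mul2r; apply/orP; right.
  rewrite cP; apply: leq_trans (leq_mul (leq_mul cA cB) cX) _.
  by rewrite eq_leq // !expnS !expn0; ring.
(* Upper bound: drop the main term, then multiply [I1] by [I2]. *)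
rewrite lerBlDr ler_wpDr //; apply: le_rhs; first exact: ler0n.
rewrite -!natrX -!natrM ler_nat expnS expn1.
apply: leq_trans (leq_mul I1 I2) _.
by rewrite eq_leq // cP !expnS !expn0; ring.
Qed.
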